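(* Let $X$ be a Cantor set and $T\in Homeo(X)$. Then, for every $\tau$-neighborhood $U$ of $T$, there exists a homeomorphism $P\in \mathcal{P}er_0(T)\cap U$ whose associated canonical partition is clopen (i.e. consists of clopen sets).
   Context: $X$ is a Cantor set and $\mathcal B$ its $\sigma$-algebra of Borel sets. $Aut(X,\mathcal B)$ is the group of all Borel bijections of $X$ onto itself, and $Homeo(X)$ is its subgroup of all homeomorphisms of $X$. For $S,T\in Aut(X,\mathcal B)$ put $E(S,T)=\{x\in X: Sx\ne Tx\}$. The uniform topology $\tau$ on $Aut(X,\mathcal B)$ has as a base the sets $$U(T;\mu_1,\ldots,\mu_n;\varepsilon)=\{S\in Aut(X,\mathcal B):\mu_i(E(S,T))<\varepsilon,\ i=1,\ldots,n\},$$ where $T\in Aut(X,\mathcal B)$, $\mu_1,\ldots,\mu_n$ are Borel probability measures on $X$, and $\varepsilon>0$. The induced topology on $Homeo(X)$ is also denoted $\tau$. For $T\in Homeo(X)$ let $Orb_T(x)=\{T^nx:n\in\mathbb Z\}$ and $[T]_C=\{S\in Homeo(X): Orb_S(x)\subseteq Orb_T(x)\text{ for all }x\in X\}$. The topological full group $[[T]]$ is the group of all $S\in[T]_C$ for which there is a continuous function $n_S:X\to\mathbb Z$ with $Sx=T^{n_S(x)}x$ for all $x\in X$. $\mathcal{P}er_0$ is the set of all $P\in Homeo(X)$ with $P^n=\mathrm{id}_X$ for some integer $n\ge1$, and $\mathcal{P}er_0(T)=\mathcal{P}er_0\cap[[T]]$. The canonical partition of $X$ associated to $P$ is $\{X_\infty,X_1,X_2,\ldots\}$,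 where $X_n$ ($n\ge1$) is the set of all points $x$ of period exactly $n$ ($P^nx=x$ and $P^ix\ne x$ for $1\le i\le n-1$) and $X_\infty$ is the set of aperiodic points ($P^nx\neq x$ for all $n\ne0$); some of these sets may be empty. *)

(* Defs.v *)
From HB Require Import structures.
From mathcomp Require Import all_boot all_order all_algebra.
From mathcomp Require Import all_classical all_reals all_analysis.

Set Implicit Arguments.
Unset Strict Implicit.
Unset Printing Implicit Defensive.

Import Order.TTheory GRing.Theory Num.Theory.
Import numFieldNormedType.Exports.

Local Open Scope classical_set_scope.
Local Open Scope ring_scope.

Definition homeomorphism (X Y : topologicalType) (f : X -> Y) : Prop :=
  exists g : Y -> X, [/\ cancel f g, cancel g f, continuous f & continuous g].

HB.mixin Record isCantor X & PointedTopological X := {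
  cantor_subproof : exists h : X -> cantor_space, homeomorphism h
}.

#[short(type="cantorType")]
HB.structure Definition Cantor := {X of PointedTopological X & isCantor X}.

Lemma cantor_space_isCantor :
  exists h : cantor_space -> cantor_space, homeomorphism h.
Proof. by exists id, id; split => // x; exact: cvg_id. Qed.

HB.instance Definition _ := isCantor.Build cantor_space cantor_space_isCantor.

Notation borel X := (g_sigma_algebraType (@open X)).

(* For a bijection of a Cantor set the last clause follows from the second one
   (Lusin-Souslin); it makes closure under inverses immediate. *)
Definition borel_bijection (X : ptopologicalType) (f : X -> X) : Prop :=
  [/\ bijective f,
      forall B, measurable (B : set (borel X)) ->
                measurable (f @^-1` B : set (borel X)) &
      forall B, measurable (B : set (borel X)) ->
                measurable (f @` B : set (borel X))].

Lemma homeomorphism_borel (X : ptopologicalType) (f : X -> X) :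
  homeomorphism f -> borel_bijection f.
Proof.
have pre (h : X -> X) : continuous h -> forall B,
    measurable (B : set (borel X)) -> measurable (h @^-1` B : set (borel X)).
  move=> /continuousP ch B mB.
  suff mh : measurable_fun [set: borel X] (h : borel X -> borel X).
    by rewrite -[_ @^-1` _]setTI; exact: mh.
  apply: (@measurability _ _ (borel X) (borel X) _ _ (@open X)) => //.
  move=> _ [V oV <-].
  by apply: sub_sigma_algebra; rewrite setTI; exact: ch.
move=> [g [fK gK cf cg]]; split; [by exists g|exact: pre|move=> B mB].
suff -> : f @` B = g @^-1` B by exact: pre.
apply/seteqP; split => [_ [x Bx <-]|y By]; first by rewrite /= fK.
by exists (g y).
Qed.

(* The real numbers R, in which the measures take their values, are a parameter
   of the type because its topology is defined from these measures. *)
Definition borel_aut (R : realType) (X : cantorType) : Type :=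
  set_type (@borel_bijection X).

HB.instance Definition _ R X := Choice.on (borel_aut R X).

Definition borel_aut_fun R X (S : borel_aut R X) : X -> X := \val S.
Coercion borel_aut_fun : borel_aut >-> Funclass.

Definition disagreement R X (S T : borel_aut R X) : set (borel X) :=
  [set x | S x <> T x].

Section uniform_topology.
Variables (R : realType) (X : cantorType).
Implicit Types S T : borel_aut R X.

Definition uniform_nbhd T (n : nat) (mu : 'I_n -> probability (borel X) R)
    (eps : R) : set (borel_aut R X) :=
  [set S | forall i, (mu i (disagreement S T) < eps%:E)%E].

Definition uniform_base : set (set (borel_aut R X)) :=
  [set A | exists T n (mu : 'I_n -> probability (borel X) R) eps,
    0 < eps /\ A = uniform_nbhd T mu eps].

Lemma measurable_disagreement S T : measurable (disagreement S T).
Proof.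
have [h [g [hK _ ch _]]] := @cantor_subproof X.
have cl (b : bool) n : measurable ([set x | h x n = b] : set (borel X)).
  apply: sub_sigma_algebra => /=.
  have /continuousP/(_ [set b]) op : continuous (fun y : cantor_space => y n).
    exact: (@proj_continuous nat (fun=> bool) n).
  move/continuousP: ch => /(_ _ (op (discrete_open _))); exact.
have -> : disagreement S T = \bigcup_n \bigcup_b
    ((S : X -> X) @^-1` [set x | h x n = b] `&`
     (T : X -> X) @^-1` [set x | h x n = ~~ b]).
  apply/seteqP; split => [x /= STx|x [n _ [b _ [/= Sb Tb]]] STx]; last first.
    by move: Tb; rewrite -STx Sb => {Sb}; case: b.
  apply: contrapT => nST; apply: STx; apply: (can_inj hK).
  apply/funext => n; apply: contrapT => hST; apply: nST.
  exists n => //; exists (h (S x) n) => //; split => //=.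
  by case: (h (S x) n) (h (T x) n) hST => -[].
apply: bigcupT_measurable => n; apply: fin_bigcup_measurable => // b _.
by apply: measurableI; [case: (set_mem (valP S)) | case: (set_mem (valP T))]
  => _ + _; exact.
Qed.

Lemma uniform_nbhd_center T S n (mu : 'I_n -> probability (borel X) R) eps :
  uniform_nbhd T mu eps S ->
  \forall e \near 0^'+, uniform_nbhd S mu e `<=` uniform_nbhd T mu eps.
Proof.
move=> TS.
have : \forall e \near (0:R)^'+,
    forall i, (mu i (disagreement S T) + e%:E < eps%:E)%E.
  apply: filter_forall => i; have := TS i.
  have := @fin_num_measure _ _ _ (mu i) _ (measurable_disagreement S T).
  move/fineK => <-; rewrite lte_fin -subr_gt0 => lt0.
  near=> e; rewrite -EFinD lte_fin -ltrBrDl; near: e; exact: nbhs_right_lt.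
apply: filterS => e He S' S'S i; apply: le_lt_trans (He i).
apply: (@le_trans _ _ (mu i (disagreement S T `|` disagreement S' S))).
  apply: le_measure; rewrite ?inE; try exact: measurable_disagreement.
    by apply: measurableU; exact: measurable_disagreement.
  move=> x /= S'T; apply/not_andP => -[ST S'S0].
  by apply: S'T; rewrite S'S0.
apply: (le_trans (measureU2 _ _ _)); try exact: measurable_disagreement.
by by apply: leeD => //; apply: ltW; exact: S'S.
Unshelve. all: by end_near. Qed.

Lemma uniform_base_cover : \bigcup_(A in uniform_base) A = setT.
Proof.
apply/seteqP; split => // S _.
exists (uniform_nbhd S (fun _ : 'I_0 => dirac (point : borel X)) 1); last by case.
by exists S, 0%N, (fun _ => dirac (point : borel X)), 1.
Qed.

Lemma uniform_base_join (A B : set (borel_aut R X)) S :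
  uniform_base A -> uniform_base B -> A S -> B S ->
  exists C, [/\ uniform_base C, C S & C `<=` A `&` B].
Proof.
move=> [T1 [n1 [mu1 [e1 [e1_gt0 ->]]]]] [T2 [n2 [mu2 [e2 [e2_gt0 ->]]]]] AS BS.
pose mu (i : 'I_(n1 + n2)) :=
  match fintype.split i with inl j => mu1 j | inr j => mu2 j end.
have [e [e_gt0 eA eB]] : exists e : R, [/\ 0 < e,
    uniform_nbhd S mu1 e `<=` uniform_nbhd T1 mu1 e1 &
    uniform_nbhd S mu2 e `<=` uniform_nbhd T2 mu2 e2].
  apply: (@filter_ex _ (0:R)^'+); near=> e; split; near: e.
  - exact: nbhs_right_gt.
  - exact: uniform_nbhd_center.
  - exact: uniform_nbhd_center.
exists (uniform_nbhd S mu e); split; first by exists S, (n1 + n2)%N, mu, e.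
  move=> i; rewrite (_ : disagreement S S = set0) ?measure0 ?lte_fin//.
  by apply/seteqP; split => x //=.
move=> S' S'S; split.
  apply: eA => i; have := S'S (lshift n2 i).
  by rewrite /mu (unsplitK (inl i)).
apply: eB => i; have := S'S (rshift n1 i).
by rewrite /mu (unsplitK (inr i)).
Unshelve. all: by end_near. Qed.

HB.instance Definition _ := isBaseTopological.Build (borel_aut R X)
  uniform_base_cover uniform_base_join.

End uniform_topology.

Definition Homeo (R : realType) (X : cantorType) : set (borel_aut R X) :=
  [set S | homeomorphism (S : X -> X)].

Definition homeo (R : realType) (X : cantorType) : Type := set_type (@Homeo R X).

HB.instance Definition _ R X := Topological.on (homeo R X).

Definition homeo_fun R X (S : homeo R X) : X -> X := \val S.
Coercion homeo_fun : homeo >-> Funclass.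

(* pinv setT f is the inverse of f when f is bijective. *)
Definition iterz (X : pointedType) (f : X -> X) (n : int) : X -> X :=
  match n with
  | Posz m => iter m f
  | Negz m => iter m.+1 (pinv setT f)
  end.

Definition orb (X : pointedType) (f : X -> X) (x : X) : set X :=
  [set iterz f n x | n in [set: int]].

Section full_groups.
Variables (R : realType) (X : cantorType).
Implicit Types S T P : homeo R X.

Definition full_group T : set (homeo R X) :=
  [set S | forall x, orb S x `<=` orb T x].

Definition topological_full_group T : set (homeo R X) :=
  [set S | full_group T S /\
    exists nS : X -> discrete_topology int,
      continuous nS /\ forall x, S x = iterz T (nS x) x].

Definition Per0 : set (homeo R X) :=
  [set P | exists n, (1 <= n)%N /\ iter n P = id].

Definition Per0_of T : set (homeo R X) := Per0 `&` topological_full_group T.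

End full_groups.

Section canonical_partition.
Variables (X : pointedType) (P : X -> X).

Definition period_set (n : nat) : set X :=
  [set x | iter n P x = x /\
    forall i, (1 <= i <= n - 1)%N -> iter i P x <> x].

Definition aperiodic_set : set X :=
  [set x | forall n : int, n <> 0 -> iterz P n x <> x].

Definition canonical_partition : set (set X) :=
  aperiodic_set |` [set period_set n | n in [set n | (1 <= n)%N]].

End canonical_partition.

(* Main.v *)
Require Import Defs.
From mathcomp Require Import all_boot all_order all_algebra.
From mathcomp Require Import all_classical all_reals all_analysis.
From mathcomp Require Import zify.

Set Implicit Arguments.
Unset Strict Implicit.
Unset Printing Implicit Defensive.

Import Order.TTheory GRing.Theory Num.Theory.

Local Open Scope classical_set_scope.

(** The periodic approximation is a Kakutani-Rokhlin tower map.  Let [A] be a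
    clopen set to which every point returns within a bounded time.  Cutting the
    orbits of [T] at their visits to [A] partitions [X] into finitely many
    towers with clopen levels; let [P] climb each tower along [T] and jump from
    its top back to its base ([tower_map]).  Then [P] lies in the topological
    full group of [T], the period of [x] under [P] is exactly the height of the
    tower of [x], and height is a bounded locally constant function.  Hence [P]
    has finite order, no aperiodic points, and a clopen canonical partition.

    It remains to choose [A] so that [P] and [T] differ only on a set which is
    small for finitely many probabilities ([tower_base]).  They differ at [x]
    exactly when [y = T x] is in [A] and the previous visit of its orbit to [A]
    is at a point [T^-r y] other than [y].  Let [c_k] be a sequence of finer and
    finer finite clopen codings of [X] which separates points.  Given [N], a
    greedy procedure over the values of [c_k] produces a clopen [A] with return
    times at most [2 N] and such that two visits to [A] less than [N] steps
    apart have the same code ([greedy_separated]).  So a bad [y] is of one of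
    two kinds:
    - [r < N]: then [y] and [T^-r y] are distinct with the same code.  For fixed
      [N] these open sets decrease to the empty set as [k] grows, so their
      measure is small for [k] large.  This is where the periodic points of
      [T] do no harm: a true return [T^-r y = y] costs nothing;
    - [r >= N]: the first [N] translates by [T] of the set of these points are
      pairwise disjoint, so one translate is light for all the given
      probabilities at once ([probability_pigeonhole]), and translating [A]
      accordingly makes the exceptional set small. *)

(** * Iterates of mutually inverse maps *)

Section iterates.
Variables (X : Type) (T G : X -> X).
Hypothesis (GK : cancel G T).

Lemma iter_can i x : iter i T (iter i G x) = x.
Proof. by elim: i x => // i IH x; rewrite iterSr iterS GK. Qed.

Lemma iter_canB i j x : (i <= j)%N ->
  iter i T (iter j G x) = iter (j - i) G x.
Proof. by move=> ij; rewrite -{1}(subnKC ij) iterD iter_can. Qed.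

End iterates.

Lemma iter_dvd (X : Type) (f : X -> X) (m n : nat) x :
  m %| n -> iter m f x = x -> iter n f x = x.
Proof.
by move=> /dvdnP[q ->] fx; elim: q => // q IH; rewrite mulSn iterD IH.
Qed.

Lemma find_iotaP (p : pred nat) M : (exists2 j, (j < M)%N & p j) ->
  [/\ (find p (iota 0 M) < M)%N, p (find p (iota 0 M)) &
      forall i, (i < find p (iota 0 M))%N -> ~~ p i].
Proof.
move=> [j jM pj].
have hp : has p (iota 0 M) by apply/hasP; exists j; rewrite ?mem_iota.
have lt : (find p (iota 0 M) < M)%N by rewrite -[X in (_ < X)%N](size_iota 0) -has_find.
split=> // [|i ilt].
  by have := nth_find 0%N hp; rewrite nth_iota.
by have := before_find 0%N ilt; rewrite nth_iota ?(ltn_trans ilt)// => ->.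
Qed.

(** * The periodic map defined by a set of bounded return time *)

Section towers.
Variables (X : Type) (T G : X -> X) (a : pred X) (M : nat).

(** Number of steps since the last visit to [a], the present counting as a
    visit.  The search is cut off at [M], which is harmless when [M] bounds the
    return times. *)
Definition age x := find (fun i => a (iter i G x)) (iota 0 M).

(** Number of steps, at least one, until the next visit to [a]. *)
Definition life x := (find (fun i => a (iter i.+1 T x)) (iota 0 M)).+1.

(** Height of the tower through [x], that is, the return time to [a] of the
    point below [x] in the base. *)
Definition height x := (age x + life x)%N.

(** The map which climbs the towers over [a] along [T] and sends the top of
    each tower, where the next step of [T] enters [a], back to its base. *)
Definition tower_map x := if a (T x) then iter (age x) G x else T x.

Hypotheses (TK : cancel T G) (GK : cancel G T).
Hypothesis return_bounded : forall x, exists2 j, (j < M)%N & a (iter j.+1 T x).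

Let ageP x : [/\ (age x < M)%N, a (iter (age x) G x) &
  forall i, (i < age x)%N -> ~~ a (iter i G x)].
Proof.
apply: (@find_iotaP (fun i => a (iter i G x))).
have [j jM aj] := return_bounded (iter M G x).
exists (M - j.+1)%N; first by lia.
by move: aj; rewrite iter_canB.
Qed.

Let lifeP x : [/\ (life x <= M)%N, a (iter (life x) T x) &
  forall i, (0 < i < life x)%N -> ~~ a (iter i T x)].
Proof.
have [h1 h2 h3] := @find_iotaP (fun i => a (iter i.+1 T x)) M (return_bounded x).
by split=> // -[//|i] /= ilt; apply: h3.
Qed.

Lemma age_unique x r : a (iter r G x) ->
  (forall i, (i < r)%N -> ~~ a (iter i G x)) -> age x = r.
Proof.
move=> ar rmin; have [_ ag gmin] := ageP x.
have [/rmin|/gmin|//] := ltngtP (age x) r; first by rewrite ag.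
by rewrite ar.
Qed.

Lemma life_unique x r : (0 < r)%N -> a (iter r T x) ->
  (forall i, (0 < i < r)%N -> ~~ a (iter i T x)) -> life x = r.
Proof.
move=> r0 ar rmin; have [_ al lmin] := lifeP x.
case: (ltngtP (life x) r) => // lt.
  by have := rmin (life x); rewrite al lt => /(_ isT).
by have := lmin r; rewrite ar lt r0 => /(_ isT).
Qed.

Lemma life_base x : life (iter (age x) G x) = height x.
Proof.
have [_ ag gmin] := ageP x; have [_ al lmin] := lifeP x.
apply: life_unique; rewrite /height; first by rewrite addnS.
  by rewrite addnC iterD (iter_can GK).
move=> i /andP[i0 ilt]; have [le|lt] := leqP i (age x).
  by rewrite (iter_canB GK)//; apply: gmin; lia.
rewrite -(subnK (ltnW lt)) iterD (iter_can GK); apply: lmin.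
by rewrite subn_gt0 lt /=; lia.
Qed.

Lemma iter_tower_map x i : (i < life x)%N -> iter i tower_map x = iter i T x.
Proof.
elim: i => // i IH ilt; rewrite !iterS IH; last exact: ltnW.
have [_ _ lmin] := lifeP x.
by rewrite /tower_map -iterS ifN// lmin.
Qed.

Lemma iter_life x : a x -> iter (life x) tower_map x = x.
Proof.
move=> ax; have [_ al lmin] := lifeP x.
case E : (life x) al => [//|r] al; rewrite iterS iter_tower_map ?E//.
rewrite /tower_map -iterS al (_ : age _ = r) ?(iter_can TK)//.
apply: age_unique => [|i ilt]; first by rewrite iter_can.
by rewrite iter_canB ?(ltnW ilt)//; apply: lmin; rewrite E; lia.
Qed.

Let iter_age x : iter (age x) tower_map (iter (age x) G x) = x.
Proof.
rewrite iter_tower_map ?(iter_can GK)// life_base /height.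
by rewrite -[X in (X < _)%N]addn0 ltn_add2l.
Qed.

Lemma iter_height x : iter (height x) tower_map x = x.
Proof.
have [_ ag _] := ageP x; rewrite -[in RHS](iter_age x) -(iter_life ag) life_base.
by rewrite -iterD addnC iterD iter_age.
Qed.

(** All heights are at most [M + M], hence divide its factorial. *)
Lemma tower_map_order x : iter (M + M)`! tower_map x = x.
Proof.
have [lta _ _] := ageP x; have [lel _ _] := lifeP x.
apply: (iter_dvd (m := height x)); last exact: iter_height.
by apply: dvdn_fact; rewrite /height leq_add ?(ltnW lta)// addnS.
Qed.

Lemma iter_tower_map_neq x i : (0 < i < height x)%N -> iter i tower_map x <> x.
Proof.
have inj : injective tower_map.
  move=> y z yz; rewrite -(tower_map_order y) -(tower_map_order z).
  by rewrite -(prednK (fact_gt0 (M + M))) !iterSr yz.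
have iinj k : injective (iter k tower_map).
  by elim: k => // k IH y z; rewrite !iterS => /inj/IH.
(* By injectivity the claim can be moved down to the base of the tower, where
   the [i]-th iterate is that of [T] and lies outside [a]. *)
move=> ilt; rewrite -[X in iter i _ X]iter_age -[X in _ <> X]iter_age.
rewrite -iterD addnC iterD => /iinj.
have [_ ag _] := ageP x; rewrite iter_tower_map ?life_base; last by case/andP: ilt.
have [_ _] := lifeP (iter (age x) G x).
by rewrite life_base => /(_ _ ilt) + E; rewrite E ag.
Qed.

(** Where the tower map differs from [T], [T x] is in [a] and the previous visit
    to [a] of its orbit, [r] steps before, was at another point. *)
Lemma tower_map_neq x : tower_map x <> T x -> exists r,
  [/\ (0 < r)%N, a (T x), a (iter r G (T x)), iter r G (T x) <> T x &
      forall i, (0 < i < r)%N -> ~~ a (iter i G (T x))].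
Proof.
rewrite /tower_map; case: ifP => // aT neq; have [_ ag gmin] := ageP x.
exists (age x).+1; split=> //; rewrite ?iterSr ?TK//.
by move=> -[//|i] /= ilt; rewrite -iterS iterSr TK; apply: gmin.
Qed.

Lemma tower_map_pow x : exists i, tower_map x = T x \/ tower_map x = iter i G x.
Proof. by exists (age x); rewrite /tower_map; case: ifP; [right|left]. Qed.

End towers.

(** * A greedy choice of a set of bounded return time *)

Section greedy.
Variables (X : Type) (T G : X -> X) (c : X -> nat) (N : nat).

(** The points of code [l'] enter the set at step [l'.+1], except those less than
    [N] steps of [T] away from a point which has already entered. *)
Fixpoint greedy (l : nat) (x : X) : bool :=
  if l is l'.+1 then
    greedy l' x || (c x == l') &&
      ~~ has (fun i => greedy l' (iter i T x) || greedy l' (iter i G x)) (iota 0 N)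
  else false.

Lemma greedy_mono l m x : (l <= m)%N -> greedy l x -> greedy m x.
Proof. by move=> /subnK <-; elim: (m - l)%N => // k IH /IH /= ->. Qed.

(** A point of the greedy set entered it at the step dictated by its own code,
    when the set was still empty nearby on its orbit. *)
Lemma greedyP l x : greedy l x -> greedy (c x).+1 x /\
  forall i, (i < N)%N -> ~~ greedy (c x) (iter i T x) && ~~ greedy (c x) (iter i G x).
Proof.
elim: l => //= l IH /orP[/IH//|/andP[/eqP -> nh]].
rewrite eqxx nh orbT; split=> // i iN.
by move: nh => /hasPn/(_ i); rewrite mem_iota iN negb_or => ->.
Qed.

Hypotheses (TK : cancel T G) (GK : cancel G T).

(** If the codes were different, the point with the larger code would have been
    excluded by the other one. *)
Lemma greedy_separated l x i : (i < N)%N ->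
  greedy l x -> greedy l (iter i G x) -> c (iter i G x) = c x.
Proof.
move=> iN /greedyP[gx hx] /greedyP[gy hy].
have [lt|lt|//] := ltngtP (c (iter i G x)) (c x).
  by have /andP[_] := hx i iN; rewrite (greedy_mono lt gy).
by have /andP[] := hy i iN; rewrite (iter_can GK) (greedy_mono lt gx).
Qed.

Lemma greedy_dense L x : (forall x, c x < L)%N -> (0 < N)%N ->
  exists2 i, (i < N)%N & greedy L (iter i T x) || greedy L (iter i G x).
Proof.
move=> cL N0; case: (boolP (has (fun i => greedy (c x) (iter i T x) ||
    greedy (c x) (iter i G x)) (iota 0 N))) => [/hasP[i]|nh].
  rewrite mem_iota => iN g; exists i => //.
  by case/orP: g => /(greedy_mono (ltnW (cL x))) ->; rewrite ?orbT.
exists 0%N => //; apply/orP; left; apply: (greedy_mono (cL x)).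
by rewrite /= eqxx nh orbT.
Qed.

Lemma greedy_return L x : (forall x, c x < L)%N -> (0 < N)%N ->
  exists2 j, (j < N + N)%N & greedy L (iter j.+1 T x).
Proof.
move=> cL N0; have [i iN /orP[g|g]] := greedy_dense (iter N T x) cL N0.
  exists (i + N).-1; first by lia.
  by rewrite prednK ?iterD//; lia.
exists (N - i).-1; first by lia.
by rewrite prednK; [rewrite -(iter_canB TK)// ltnW|lia].
Qed.

End greedy.

(** * Locally constant functions *)

Section locally_constant.
Variable X : topologicalType.

(** Local constancy in terms of neighbourhoods only, so that no topology is
    needed on the codomain. *)
Definition loc_const (Y : Type) (f : X -> Y) : Prop :=
  forall x, \forall y \near x, f y = f x.

Lemma loc_const_cst (Y : Type) (y : Y) : loc_const (fun=> y).
Proof. by move=> x; apply: nearW. Qed.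

Lemma loc_const_op2 (Y Z W : Type) (h : Y -> Z -> W) f g :
  loc_const f -> loc_const g -> loc_const (fun x => h (f x) (g x)).
Proof. by move=> lf lg x; apply: filterS2 (lf x) (lg x) => y -> ->. Qed.

Lemma loc_const_op1 (Y Z : Type) (h : Y -> Z) f :
  loc_const f -> loc_const (fun x => h (f x)).
Proof. by move=> lf x; apply: filterS (lf x) => y ->. Qed.

Lemma loc_const_comp (Y : Type) (f : X -> Y) (T : X -> X) :
  continuous T -> loc_const f -> loc_const (f \o T).
Proof. by move=> cT lf x; exact: (cT x _ (lf (T x))). Qed.

Lemma continuous_iter (T : X -> X) i : continuous T -> continuous (iter i T).
Proof.
move=> cT; elim: i => [|i IH] x; first exact: cvg_id.
by apply: (@continuous_comp _ _ _ (iter i T) T); [exact: IH|exact: cT].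
Qed.

Lemma loc_const_iter (Y : Type) (f : X -> Y) (T : X -> X) i :
  continuous T -> loc_const f -> loc_const (fun x => f (iter i T x)).
Proof.
by move=> cT; apply: (@loc_const_comp _ f (iter i T)); exact: continuous_iter.
Qed.

Lemma loc_const_map (I Y : Type) (f : I -> X -> Y) (s : seq I) :
  (forall i, loc_const (f i)) -> loc_const (fun x => [seq f i x | i <- s]).
Proof.
move=> lf; elim: s => [|i s IH] /=; first exact: loc_const_cst.
exact: loc_const_op2.
Qed.

Lemma loc_const_find (I : Type) (f : I -> X -> bool) (s : seq I) :
  (forall i, loc_const (f i)) -> loc_const (fun x => find (f^~ x) s).
Proof.
move=> /(@loc_const_map _ _ _ s)/(loc_const_op1 (find id)).
by under eq_fun do rewrite find_map.
Qed.

Lemma loc_const_has (I : Type) (f : I -> X -> bool) (s : seq I) :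
  (forall i, loc_const (f i)) -> loc_const (fun x => has (f^~ x) s).
Proof.
move=> /(@loc_const_map _ _ _ s)/(loc_const_op1 (has id)).
by under eq_fun do rewrite has_map.
Qed.

Lemma loc_const_open (Y : Type) (f : X -> Y) (B : set Y) :
  loc_const f -> open (f @^-1` B).
Proof.
by move=> lf; rewrite openE => x Bx; apply: filterS (lf x) => y /= ->.
Qed.

Lemma loc_const_clopen (Y : Type) (f : X -> Y) (B : set Y) :
  loc_const f -> clopen (f @^-1` B).
Proof.
move=> lf; split; first exact: loc_const_open.
by rewrite -openC preimage_setC; exact: loc_const_open.
Qed.

Lemma loc_const_continuous (Y : topologicalType) (f : X -> Y) :
  loc_const f -> continuous f.
Proof.
move=> lf x B /nbhs_singleton Bx; apply: filterS (lf x) => y /= ->.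
exact: Bx.
Qed.

Variables (T G : X -> X) (a : pred X) (M : nat).
Hypotheses (cT : continuous T) (cG : continuous G) (la : loc_const a).

Lemma loc_const_age : loc_const (age G a M).
Proof.
by apply: (@loc_const_find _ (fun i x => a (iter i G x))) => i; exact: (@loc_const_iter _ a G).
Qed.

Lemma loc_const_height : loc_const (height T G a M).
Proof.
apply: loc_const_op2; first exact: loc_const_age.
apply: loc_const_op1; apply: (@loc_const_find _ (fun i x => a (iter i.+1 T x))) => i.
exact: (@loc_const_iter _ a T i.+1).
Qed.

Lemma loc_const_greedy (c : X -> nat) (N l : nat) :
  loc_const c -> loc_const (greedy T G c N l).
Proof.
move=> lc; elim: l => [|l IH] /=; first exact: loc_const_cst.
apply: loc_const_op2 => //; apply: loc_const_op2; first exact: (loc_const_op1 (eq_op^~ l) lc).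
apply: loc_const_op1.
apply: (@loc_const_has _ (fun i x => greedy T G c N l (iter i T x) ||
  greedy T G c N l (iter i G x))) => i.
by apply: loc_const_op2; [exact: (@loc_const_iter _ _ T)|exact: (@loc_const_iter _ _ G)].
Qed.

End locally_constant.

(** * Finite codes separating the points of a Cantor set *)

(** The codings [c k] are finite and locally constant, refine each other, and
    together separate points. *)
Lemma cantor_codes (X : cantorType) : exists c : nat -> X -> nat,
  [/\ forall k, loc_const (c k),
      forall k x, (c k x < 2 ^ k)%N,
      forall k l x y, (k <= l)%N -> c l x = c l y -> c k x = c k y &
      forall x y, x <> y -> exists k, c k x <> c k y].
Proof.
have [h [g [hK _ ch _]]] := @cantor_subproof X.
(* The number whose binary digits are the first [k] coordinates of [x]. *)
pose c := fix c k x := if k is k'.+1 then (h x k' + (c k' x).*2)%N else 0%N.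
have cS k x y : c k.+1 x = c k.+1 y -> h x k = h y k /\ c k x = c k y.
  move=> E; have hE : h x k = h y k.
    by move/(congr1 odd): E; rewrite /= !oddD !odd_double !addbF !oddb.
  by move/eqP: E; rewrite /= hE eqn_add2l => /eqP/double_inj.
exists c; split.
- have lh k : loc_const (fun x => h x k).
    move=> x; have cpr : continuous (fun y : cantor_space => y k).
      exact: (@proj_continuous nat (fun=> bool) k).
    have ct := @continuous_comp _ _ _ h (fun y : cantor_space => y k) x (ch x) (cpr (h x)).
    exact: (ct _ (discrete_set1 (h x k))).
  elim=> [|k IH] /=; first exact: loc_const_cst.
  by apply: (loc_const_op2 (fun b n => (nat_of_bool b + n.*2)%N)) => //.
- by elim=> //= k IH x; rewrite expnS; have := IH x; case: (h x k) => /=; lia.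
- move=> k l x y /subnK <-; elim: (l - k)%N => // i IH.
  by rewrite addSn => /cS[_ /IH].
- move=> x y xy; apply: contrapT => nc; apply: xy; apply: (can_inj hK).
  apply/funext => k; have /cS[] // : c k.+1 x = c k.+1 y.
  by apply: contrapT => E; apply: nc; exists k.+1.
Qed.

(** * Two measure estimates *)

(** Continuity from above at the empty set. *)
Lemma probability_small_near d (Y : measurableType d) (R : realType)
    (mu : probability Y R) (F : nat -> set Y) (e : R) :
  (0 < e)%R -> (forall k, measurable (F k)) ->
  (forall k l, (k <= l)%N -> F l `<=` F k) -> \bigcap_k F k = set0 ->
  \forall k \near \oo, (mu (F k) < e%:E)%E.
Proof.
move=> e0 mF dF F0.
have cv : (mu \o F) k @[k --> \oo] --> mu (\bigcap_k F k).
  apply: nonincreasing_cvg_mu => //.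
  - by apply: (le_lt_trans (probability_le1 mu (mF 0%N))); rewrite ltry.
  - exact: bigcap_measurable.
  - by move=> k l kl; apply/subsetPset; exact: dF.
have ne : nbhs (mu (\bigcap_k F k)) [set y | (y < e%:E)%E].
  rewrite F0 measure0; apply: open_nbhs_nbhs; split.
    exact: open_ereal_lt_ereal.
  by rewrite /= lte_fin.
exact: (cv _ ne).
Qed.

(** Pigeonhole: the [m] probabilities give the [N] disjoint sets total mass at
    most [m], so some set is light for all of them as soon as [m < N * e]. *)
Lemma probability_pigeonhole d (Y : measurableType d) (R : realType) (m N : nat)
    (mu : 'I_m -> probability Y R) (F : 'I_N -> set Y) (e : R) :
  (forall j, measurable (F j)) -> trivIset setT F -> (m%:R < e *+ N)%R ->
  exists j, forall i, (mu i (F j) < e%:E)%E.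
Proof.
move=> mF tF mN; apply: contrapT => no.
suff : ((e *+ N)%:E <= m%:R%:E :> \bar R)%E by rewrite lee_fin leNgt mN.
have heavy j : (e%:E <= \sum_(i < m) mu i (F j))%E.
  have [i ei] : exists i, (e%:E <= mu i (F j))%E.
    apply: contrapT => nei; apply: no; exists j => i; rewrite ltNge.
    by apply/negP => ei; apply: nei; exists i.
  by apply: (le_trans ei); rewrite (bigD1 i)//= leeDl// sume_ge0.
apply: (@le_trans _ _ (\sum_(j < N) \sum_(i < m) mu i (F j))%E).
  have -> : ((e *+ N)%:E = \sum_(j < N) e%:E)%E.
    by rewrite sumEFin big_const_ord iter_addr_0.
  by apply: lee_sum => j _.
rewrite exchange_big /=.
have -> : (m%:R%:E = \sum_(i < m) 1 :> \bar R)%E.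
  by rewrite sumEFin big_const_ord iter_addr_0.
apply: lee_sum => i _; rewrite -(@measure_bigsetU_ord _ _ _ (mu i) _ xpredT)//.
by apply: probability_le1; exact: bigsetU_measurable.
Qed.

(** * Choice of the base *)

Lemma open_borel (X : ptopologicalType) (B : set X) :
  open B -> measurable (B : set (borel X)).
Proof. exact: sub_sigma_algebra. Qed.

(** For every finite family of probabilities, some clopen set of bounded return
    time has a tower map close to [T]; the set of disagreement is bounded by a
    Borel set [D], so that its own measurability plays no role here. *)
Lemma tower_base (R : realType) (X : cantorType) (T G : X -> X) (m : nat)
    (mu : 'I_m -> probability (borel X) R) (e : R) :
  cancel T G -> cancel G T -> continuous T -> continuous G -> (0 < e)%R ->
  exists (a : pred X) (M : nat) (D : set (borel X)),
    [/\ loc_const a, forall x, exists2 j, (j < M)%N & a (iter j.+1 T x),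
        measurable D, [set x | tower_map T G a M x <> T x] `<=` D &
        forall i, (mu i D < e%:E)%E].
Proof.
move=> TK GK cT cG e0; have [c [lc cb cm cs]] := cantor_codes X.
have e20 : (0 < e / 2)%R by apply: divr_gt0.
(* [N] makes the pigeonhole argument work for the [m] probabilities. *)
have [N mN] : exists N, (m%:R < (e / 2) *+ N)%R.
  exists (Num.truncn (m%:R / (e / 2))).+1.
  by rewrite -(mulr_natl (e / 2)) -ltr_pdivrMr// truncnS_gt.
have N0 : (0 < N)%N.
  by case: N mN => // ; rewrite mulr0n ltrn0.
(* Distinct points of the same orbit, close in time, with the same code. *)
pose E k : set X := [set z | exists r : 'I_N,
  iter r G z <> z /\ c k (iter r G z) = c k z].
have oE k : open (E k).
  rewrite openE => z [r [rz ck]]; have [k0 ck0] := cs _ _ rz.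
  have li l := @loc_const_iter _ _ (c l) G r cG (lc l).
  apply: filterS (filterI (filterI (lc k z) (li k z)) (filterI (lc k0 z) (li k0 z))).
  move=> y /= [[e1 e2] [e3 e4]]; exists r; split; last by rewrite e2 e1.
  by move=> ry; apply: ck0; rewrite -e3 -e4 ry.
(* The base used in the end is the translate of a greedy set by [T^j]; since the
   disagreement at [x] is read off at [T x], the map [s j] brings [x] back to
   the greedy set itself. *)
pose s (j : nat) := iter j G \o T.
have csj j : continuous (s j).
  move=> x; apply: (@continuous_comp _ _ _ T (iter j G)); first exact: cT.
  exact: continuous_iter.
have [k kE] : exists k, forall (j : 'I_N) (i : 'I_m),
    (mu i (s j @^-1` E k) < (e / 2)%:E)%E.
  suff /filter_ex[k kE] : \forall k \near \oo, forall (j : 'I_N) (i : 'I_m),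
    (mu i (s j @^-1` E k) < (e / 2)%:E)%E by exists k.
  apply: filter_forall => j; apply: filter_forall => i.
  apply: probability_small_near => //.
  - by move=> k; apply: open_borel; move/continuousP: (csj j); exact.
  - move=> k l kl x [r [rz cr]]; exists r; split=> //; exact: cm kl _.
  apply/seteqP; split=> // x Ex.
  have /filter_ex[k nE] : \forall k \near \oo,
      forall r : 'I_N, ~ (iter r G (s j x) <> s j x /\
                          c k (iter r G (s j x)) = c k (s j x)).
    apply: filter_forall => r; have [->|/eqP rz] := eqVneq (iter r G (s j x)) (s j x).
      by apply: nearW => k [].
    have [k0 ck0] := cs _ _ rz.
    by apply: filterS (nbhs_infty_ge k0) => k kk0 [_ ck]; apply/ck0/(cm _ _ _ _ kk0).
  by have [r] := Ex k I; exact: nE.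
pose a0 := greedy T G (c k) N (2 ^ k).
have la0 : loc_const a0 by exact: loc_const_greedy.
(* Points of the greedy set without an earlier visit less than [N] steps before. *)
pose rare z := a0 z && ~~ has (fun i => a0 (iter i.+1 G z)) (iota 0 N.-1).
have lrare : loc_const rare.
  apply: loc_const_op2 => //; apply: loc_const_op1.
  apply: (@loc_const_has _ _ (fun i x => a0 (iter i.+1 G x))) => i.
  exact: (@loc_const_iter _ _ a0 G i.+1).
have mrare j : measurable (s j @^-1` [set` rare] : set (borel X)).
  apply: open_borel; move/continuousP: (csj j); apply.
  exact: (@loc_const_open _ _ rare [set b | b]).
have [j jF] : exists j : 'I_N, forall i,
    (mu i (s j @^-1` [set` rare] : set (borel X)) < (e / 2)%:E)%E.
  apply: probability_pigeonhole => //.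
  have disj (i j : 'I_N) x : (i < j)%N -> rare (s i x) -> rare (s j x) -> False.
    move=> ij /andP[_ /hasPn ni] /andP[aj _].
    have := ni (j - i).-1; rewrite mem_iota prednK ?subn_gt0//.
    rewrite -iterD subnK ?(ltnW ij)// aj => /(_ _)/negP; apply => //.
    by have := ltn_ord j; lia.
  move=> i j _ _ [x [/= xi xj]]; apply: val_inj.
  have [ij|ij|//] := ltngtP i j; first by case: (disj _ _ _ ij xi xj).
  by case: (disj _ _ _ ij xj xi).
pose a := a0 \o iter j G.
have iterC i x : iter j G (iter i G x) = iter i G (iter j G x).
  by rewrite -!iterD addnC.
have iterTC i x : iter j G (iter i T x) = iter i T (iter j G x).
  elim: i x => //= i IH x; rewrite -IH.
  elim: (nat_of_ord j) (iter i T x) => //= l IHl y; rewrite IHl.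
  by rewrite TK GK.
have retA x : exists2 i, (i < N + N)%N & a (iter i.+1 T x).
  have [i iN ai] := greedy_return TK (iter j G x) (cb k) N0.
  by exists i => //; rewrite /a /= -/(iter i.+1 T x) iterTC.
have mE : measurable (s j @^-1` E k : set (borel X)).
  by apply: open_borel; move/continuousP: (csj j); exact.
exists a, (N + N)%N, (s j @^-1` E k `|` s j @^-1` [set` rare]); split=> //.
- exact: loc_const_iter.
- exact: measurableU.
- move=> x /= /(tower_map_neq TK GK retA)[r [r0 aT ar rx rmin]].
  rewrite /a /= !iterC in aT ar; have [rN|rN] := ltnP r N.
    left; exists (Ordinal rN); split=> /=.
      move=> E1; apply: rx; apply: (can_inj (iter_can GK j)).
      by rewrite /s /= in E1; rewrite iterC E1.
    exact: (greedy_separated GK rN aT ar).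
  right; change (is_true (rare (s j x))); rewrite /rare {1}/s /= aT.
  apply/hasPn => i; rewrite mem_iota => iN.
  have := rmin i.+1; rewrite /a /= -/(iter i.+1 G _) iterC; apply.
  by lia.
- move=> i; apply: (le_lt_trans (measureU2 _ mE (mrare j))).
  by rewrite [e]splitr EFinD; apply: lteD; [exact: kE|exact: jF].
Qed.

(** * The topological full group and the uniform topology *)

Section powers.
Variables (X : pointedType) (T G : X -> X).
Hypotheses (TK : cancel T G) (GK : cancel G T).

Lemma pinv_cancel : pinv setT T = G.
Proof.
apply/funext => y; apply: (can_inj TK); rewrite GK pinvK//.
by apply/mem_set; exists (G y).
Qed.

Lemma iterz_opp i : iterz T (- Posz i)%R = iter i G.
Proof. by case: i => // i; rewrite -NegzE /= pinv_cancel. Qed.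

Lemma orbP x y : orb T x y <-> exists i, y = iter i T x \/ y = iter i G x.
Proof.
split=> [[[i|i] _ <-]|[i [->|->]]].
- by exists i; left.
- by exists i.+1; right; rewrite /= pinv_cancel.
- by exists (Posz i).
- by exists (- Posz i)%R => //; rewrite iterz_opp.
Qed.

Lemma orb_refl x : orb T x x.
Proof. by exists 0%R. Qed.

Lemma orb_iter x y i : orb T x y -> orb T x (iter i T y).
Proof.
move=> xy; elim: i => // i /orbP[j [E|E]]; rewrite iterS E; apply/orbP.
  by exists j.+1; left.
by case: j {E} => [|j]; [exists 1%N; left|exists j; right; rewrite iterS GK].
Qed.

Lemma orb_iterV x y i : orb T x y -> orb T x (iter i G y).
Proof.
move=> xy; elim: i => // i /orbP[j [E|E]]; rewrite iterS E; apply/orbP.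
  by case: j {E} => [|j]; [exists 1%N; right|exists j; left; rewrite iterS TK].
by exists j.+1; right.
Qed.

End powers.

(** Every neighborhood of [T] contains a basic one centered at [T]; the basic
    set provided by the topology may have another center. *)
Lemma nbhs_homeo (R : realType) (X : cantorType) (T : homeo R X)
    (U : set (homeo R X)) : nbhs T U ->
  exists (m : nat) (mu : 'I_m -> probability (borel X) R) (e : R), (0 < e)%R /\
    forall S : homeo R X, uniform_nbhd (\val T) mu e (\val S) -> U S.
Proof.
rewrite nbhsE => -[B [[A [D' D'base <-] <-] [A0 DA0 A0T]] BU].
have [T' [m [mu [e' [e'0 A0E]]]]] := D'base _ DA0.
rewrite A0E in A0T.
have [e [e0 eA0]] : exists e : R, (0 < e)%R /\
    uniform_nbhd (\val T) mu e `<=` uniform_nbhd T' mu e'.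
  apply: (@filter_ex _ (0 : R)^'+)%R; near=> e; split; near: e.
    exact: nbhs_right_gt.
  exact: uniform_nbhd_center.
exists m, mu, e; split=> // S /eA0 SA; apply: BU; exists A0 => //.
by rewrite A0E.
Unshelve. all: by end_near. Qed.

Theorem corollary2p2 (R : realType) (X : cantorType) (T : homeo R X)
    (U : set (homeo R X)) :
  nbhs T U ->
  exists P : homeo R X, [/\ Per0_of T P, U P &
    forall A, canonical_partition P A -> clopen (A : set X)].
Proof.
move=> /nbhs_homeo[m [mu [e [e0 muU]]]].
have [G [TK GK cT cG]] : homeomorphism (T : X -> X) := set_mem (valP T).
have [a [M [D [la ret mD sub muD]]]] := tower_base mu TK GK cT cG e0.
pose p := tower_map T G a M.
have pM := tower_map_order TK GK ret; rewrite -/p in pM.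
(* The cocycle of the tower map. *)
pose nS x : int := if a (T x) then (- Posz (age G a M x))%R else 1%R.
have pE x : p x = iterz T (nS x) x.
  by rewrite /p /nS /tower_map; case: ifP => // _; rewrite (iterz_opp TK GK).
have lage := @loc_const_age _ G a M cG la.
have lnS : loc_const nS.
  apply: (@loc_const_op2 _ _ _ _ (fun (b : bool) n => if b then (- Posz n)%R else 1%R)).
    exact: (@loc_const_comp _ _ a T cT la).
  exact: lage.
have cz z : continuous (iterz T z).
  case: z => i; first exact: continuous_iter.
  by rewrite /= (pinv_cancel TK GK); exact: (@continuous_iter _ G i.+1 cG).
have cp : continuous p.
  move=> x; have [z zE] : exists z, nS x = z by exists (nS x).
  have px : p x = iterz T z x by rewrite pE zE.
  rewrite /continuous_at px; apply: cvg_trans (cz z x).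
  by apply: near_eq_cvg; apply: filterS (lnS x) => y; rewrite pE => ->; rewrite zE.
(* As [p] has finite order, a power of it is its inverse. *)
pose q := iter ((M + M)`!).-1 p.
have pK : cancel p q by move=> x; rewrite /q -iterSr prednK ?fact_gt0.
have qK : cancel q p by move=> x; rewrite /q -iterS prednK ?fact_gt0.
have hp : homeomorphism p by exists q; split=> //; exact: continuous_iter.
pose P : homeo R X :=
  exist _ (exist _ p (mem_set (homeomorphism_borel hp)) : borel_aut R X) (mem_set hp).
have PE : (P : X -> X) = p by [].
have orbp x i : orb T x (iter i p x).
  elim: i => [|i IH]; first exact: orb_refl.
  have [j] := tower_map_pow T G a M (iter i p x).
  rewrite -/p iterS => -[->|->].
    exact: (orb_iter TK GK 1).
  exact: (orb_iterV TK GK).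
exists P; split.
- split; first by exists (M + M)`!; split; [exact: fact_gt0|apply/funext].
  split.
    move=> x _ [[i|i] _ <-]; rewrite PE; first exact: orbp.
    rewrite /= (pinv_cancel pK qK) -iterS /q -iterM; exact: orbp.
  by exists nS; split=> //; exact: loc_const_continuous.
- apply: muU => i; apply: le_lt_trans (muD i); apply: le_measure; rewrite ?inE//.
  exact: measurable_disagreement.
- move=> A [->|[k /= k1 <-]].
    rewrite (_ : aperiodic_set _ = set0); first by split; [exact: open0|exact: closed0].
    apply/seteqP; split=> // x /(_ (Posz (M + M)`!)); apply; last exact: pM.
    by apply/eqP; rewrite -lt0n fact_gt0.
  rewrite (_ : period_set _ _ = height T G a M @^-1` [set k]).
    by apply: loc_const_clopen; exact: loc_const_height.
  rewrite PE; apply/seteqP; split=> x /=.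
    have h1 : (0 < height T G a M x)%N by rewrite /height addnS.
    move=> [pk kmin]; case: (ltngtP (height T G a M x) k) => // lt.
      case: (kmin (height T G a M x)); first by rewrite h1 /=; lia.
      exact: iter_height.
    by case: (iter_tower_map_neq TK GK ret (i := k) (x := x)) => //; rewrite lt andbT.
  move=> <-; split; first exact: iter_height.
  move=> i ilt; apply: (iter_tower_map_neq TK GK ret).
  by move: (height _ _ _ _ _) ilt => h; lia.
Qed.
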